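(* Let $$G=\left\langle a,b,t \;\middle|\; t^{-1}at = b,\ t^{-1}bt = aba^{-1}\right\rangle ,$$ and for each integer $s\ge 3$ let $$G_s=\left\langle a,b,t \;\middle|\; t^{-1}at=b,\ t^{-1}bt = W_s(b,a)\,b\,(W_s(a,b))^{-1}\right\rangle ,$$ where $W_s(x,y)= x y^4 x y^5 x\cdots x y^{4+s} x=\bigl(\prod_{i=4}^{4+s} x y^{i}\bigr)x$ (product in increasing order of $i$ from left to right). Then $G$ is not subgroup separable, and for every $s\ge 3$ the group $G_s$ is not subgroup separable.
   Context: A group $\Gamma$ is subgroup separable if every finitely generated subgroup of $\Gamma$ is closed in the profinite topology, i.e. for every finitely generated subgroup $L\le \Gamma$ and every $g\in\Gamma\setminus L$ there is a homomorphism $\pi$ from $\Gamma$ to a finite group with $\pi(g)\notin\pi(L)$. $W_s(b,a)$ (respectively $W_s(a,b)$) denotes the word obtained from $W_s(x,y)$ by substituting $x=b,\ y=a$ (respectively $x=a,\ y=b$). *)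

(* Defs.v *)
From HB Require Import structures.
From mathcomp Require Import fingroup all_boot.
From mathcomp Require Import boolp classical_sets cardinality.

Set Implicit Arguments.
Unset Strict Implicit.
Unset Printing Implicit Defensive.

Local Open Scope classical_set_scope.
Local Open Scope quotient_scope.
Local Open Scope group_scope.

Definition is_subgroup (G : groupType) (L : set G) : Prop :=
  L 1 /\ forall x y, L x -> L y -> L (x / y).

Definition is_normal_subgroup (G : groupType) (N : set G) : Prop :=
  is_subgroup N /\ forall x g, N x -> N (x ^ g).

Definition generated_subgroup (G : groupType) (A : set G) : set G :=
  smallest (@is_subgroup G) A.

Definition normal_closure (G : groupType) (A : set G) : set G :=
  smallest (@is_normal_subgroup G) A.

Definition finitely_generated (G : groupType) (L : set G) : Prop :=
  exists2 A : set G, finite_set A & L = generated_subgroup A.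

(** Closedness of [L] in the profinite topology, unfolded. *)
Definition subgroup_separable (G : groupType) : Prop :=
  forall L : set G, finitely_generated L ->
  forall g : G, ~ L g ->
  exists (H : finGroupType) (f : {multiplicative G -> H}), ~ (f @` L) (f g).

Section FreeGroup.
Variable X : choiceType.

(** The letter [(x, false)] stands for [x] and [(x, true)] for its inverse. *)
Definition word : Type := seq (X * bool).

Inductive free_eq : word -> word -> Prop :=
| free_eq_refl u : free_eq u u
| free_eq_sym u v : free_eq u v -> free_eq v u
| free_eq_trans u v w : free_eq u v -> free_eq v w -> free_eq u w
| free_eq_cancel u v x e :
    free_eq (u ++ [:: (x, e); (x, ~~ e)] ++ v) (u ++ v).

Definition word_inv (u : word) : word := rev [seq (p.1, ~~ p.2) | p <- u].

Lemma free_eq_cat u u' v v' :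
  free_eq u u' -> free_eq v v' -> free_eq (u ++ v) (u' ++ v').
Proof.
have catr w w' z : free_eq w w' -> free_eq (w ++ z) (w' ++ z).
  elim=> {w w'} [w|w w' _|w w' w'' _ IH1 _|w w' x e].
  - exact: free_eq_refl.
  - exact: free_eq_sym.
  - exact: free_eq_trans.
  - by rewrite -!catA; exact: free_eq_cancel.
have catl z w w' : free_eq w w' -> free_eq (z ++ w) (z ++ w').
  elim=> {w w'} [w|w w' _|w w' w'' _ IH1 _|w w' x e].
  - exact: free_eq_refl.
  - exact: free_eq_sym.
  - exact: free_eq_trans.
  - by rewrite (catA z) (catA z); exact: free_eq_cancel.
by move=> uu' vv'; apply: free_eq_trans (catr _ _ v uu') (catl u' _ _ vv').
Qed.

Lemma free_eq_inv u v : free_eq u v -> free_eq (word_inv u) (word_inv v).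
Proof.
elim=> {u v} [u|u v _|u v w _ IH1 _|u v x e].
- exact: free_eq_refl.
- exact: free_eq_sym.
- exact: free_eq_trans.
- rewrite /word_inv !map_cat !rev_cat -catA.
  have -> : rev [seq (p.1, ~~ p.2) | p <- [:: (x, e); (x, ~~ e)]]
    = [:: (x, e); (x, ~~ e)] by rewrite /= /rev /= negbK.
  exact: free_eq_cancel.
Qed.

Lemma free_eq_Vcat u : free_eq (word_inv u ++ u) [::].
Proof.
elim: u => [|[x e] u IH]; first exact: free_eq_refl.
rewrite /word_inv map_cons rev_cons cat_rcons /= -{2}[e]negbK.
exact: (free_eq_trans (free_eq_cancel _ u x (~~ e))).
Qed.

Lemma free_eq_catV u : free_eq (u ++ word_inv u) [::].
Proof.
have {1}-> : u = word_inv (word_inv u).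
  by rewrite /word_inv map_rev revK -map_comp map_id_in // => -[x e] _ /=; rewrite negbK.
exact: free_eq_Vcat.
Qed.

Definition free_eqb (u v : word) : bool := `[< free_eq u v >].

Lemma free_eqb_equiv : equiv_class_of free_eqb.
Proof.
split=> [u|u v|v u w].
- exact/asboolP/free_eq_refl.
- by apply/asboolP/asboolP; exact: free_eq_sym.
- by move=> /asboolP uv /asboolP vw; apply/asboolP; exact: free_eq_trans vw.
Qed.

Canonical free_eqb_equiv_rel := EquivRelPack free_eqb_equiv.

Definition free_group : Type := {eq_quot free_eqb_equiv_rel}.
HB.instance Definition _ := Choice.on free_group.

Definition free_class (u : word) : free_group := \pi_{eq_quot free_eqb_equiv_rel} u.

Lemma free_classP u v : free_class u = free_class v <-> free_eq u v.
Proof.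
by split=> [/eqmodP/asboolP//|uv]; apply/eqmodP/asboolP.
Qed.

Lemma free_class_repr (x : free_group) : free_class (repr x) = x.
Proof. exact: reprK. Qed.

Definition free_one : free_group := free_class [::].
Definition free_mul (x y : free_group) : free_group :=
  free_class (repr x ++ repr y).
Definition free_inv (x : free_group) : free_group :=
  free_class (word_inv (repr x)).

Lemma free_mulE u v :
  free_mul (free_class u) (free_class v) = free_class (u ++ v).
Proof.
by apply/free_classP/free_eq_cat; apply/free_classP; rewrite free_class_repr.
Qed.

Lemma free_invE u : free_inv (free_class u) = free_class (word_inv u).
Proof. by apply/free_classP/free_eq_inv/free_classP; rewrite free_class_repr. Qed.

Lemma free_mulA : associative free_mul.
Proof.
move=> x y z; rewrite -[x]free_class_repr -[y]free_class_repr -[z]free_class_repr.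
by rewrite !free_mulE catA.
Qed.

Lemma free_mul1 : left_id free_one free_mul.
Proof. by move=> x; rewrite -[x]free_class_repr free_mulE. Qed.

Lemma free_mulr1 : right_id free_one free_mul.
Proof. by move=> x; rewrite -[x]free_class_repr free_mulE cats0. Qed.

Lemma free_mulV : left_inverse free_one free_inv free_mul.
Proof.
move=> x; rewrite -[x]free_class_repr free_invE free_mulE.
exact/free_classP/free_eq_Vcat.
Qed.

Lemma free_mulrV : right_inverse free_one free_inv free_mul.
Proof.
move=> x; rewrite -[x]free_class_repr free_invE free_mulE.
exact/free_classP/free_eq_catV.
Qed.

HB.instance Definition _ := isGroup.Build free_group
  free_mulA free_mul1 free_mulr1 free_mulV free_mulrV.

Definition free_gen (x : X) : free_group := free_class [:: (x, false)].

End FreeGroup.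

Section PresentedGroup.
Variables (X : choiceType) (R : set (free_group X)).
Local Notation F := (free_group X).
Local Notation N := (normal_closure R).

Lemma normal_closureP : is_normal_subgroup N.
Proof.
split; first split=> [M [[[M1 _] _] _] //|x y Nx Ny M MP].
  by have [[_ MF] _] := MP.1; apply: MF; [exact: Nx|exact: Ny].
by move=> x g Nx M MP; apply: MP.1.2; exact: Nx.
Qed.

Definition rel_eqb (x y : F) : bool := `[< N (x / y) >].

Lemma rel_eqb_equiv : equiv_class_of rel_eqb.
Proof.
have [[N1 NF] _] := normal_closureP.
have NV x : N x -> N x^-1 by move=> Nx; rewrite -div1g; exact: NF.
split=> [x|x y|y x z].
- by apply/asboolP; rewrite divgg.
- by apply/asboolP/asboolP => /NV; rewrite invgF.
- move=> /asboolP xy /asboolP yz; apply/asboolP.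
  have -> : x / z = (x / y) / (z / y) by rewrite invgF mulgA mulgVK.
  by apply: NF => //; rewrite -invgF; exact: NV.
Qed.

Canonical rel_eqb_equiv_rel := EquivRelPack rel_eqb_equiv.

Definition presented_group : Type := {eq_quot rel_eqb_equiv_rel}.
HB.instance Definition _ := Choice.on presented_group.

Definition presented_class (x : F) : presented_group :=
  \pi_{eq_quot rel_eqb_equiv_rel} x.

Lemma presented_classP x y :
  presented_class x = presented_class y <-> N (x / y).
Proof.
by split=> [/eqmodP/asboolP//|xy]; apply/eqmodP/asboolP.
Qed.

Lemma presented_class_repr (x : presented_group) : presented_class (repr x) = x.
Proof. exact: reprK. Qed.

Definition presented_one : presented_group := presented_class 1.
Definition presented_mul (x y : presented_group) : presented_group :=
  presented_class (repr x * repr y).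
Definition presented_inv (x : presented_group) : presented_group :=
  presented_class (repr x)^-1.

Lemma presented_mulE x y :
  presented_mul (presented_class x) (presented_class y) = presented_class (x * y).
Proof.
have [[N1 NF] NJ] := normal_closureP.
have NV z : N z -> N z^-1 by move=> Nz; rewrite -div1g; exact: NF.
apply/presented_classP.
set x' := repr _; set y' := repr _.
have Nx : N (x' / x) by apply/presented_classP; rewrite presented_class_repr.
have Ny : N (y' / y) by apply/presented_classP; rewrite presented_class_repr.
have -> : (x' * y') / (x * y) = (y' / y) ^ x'^-1 / (x / x').
  by rewrite /conjg invgK invgF invMg !mulgA mulgVK.
by apply: NF; [exact: NJ|rewrite -invgF; exact: NV].
Qed.

Lemma presented_invE x :
  presented_inv (presented_class x) = presented_class x^-1.
Proof.
have [[N1 NF] NJ] := normal_closureP.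
have NV z : N z -> N z^-1 by move=> Nz; rewrite -div1g; exact: NF.
apply/presented_classP; set x' := repr _.
have Nx : N (x' / x) by apply/presented_classP; rewrite presented_class_repr.
have -> : x'^-1 / x^-1 = (x' / x)^-1 ^ x'.
  by rewrite /conjg invgF invgK !mulgA mulgVK.
by apply: NJ; exact: NV.
Qed.

Lemma presented_mulA : associative presented_mul.
Proof.
move=> x y z.
rewrite -[x]presented_class_repr -[y]presented_class_repr -[z]presented_class_repr.
by rewrite !presented_mulE mulgA.
Qed.

Lemma presented_mul1 : left_id presented_one presented_mul.
Proof. by move=> x; rewrite -[x]presented_class_repr presented_mulE mul1g. Qed.

Lemma presented_mulr1 : right_id presented_one presented_mul.
Proof. by move=> x; rewrite -[x]presented_class_repr presented_mulE mulg1. Qed.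

Lemma presented_mulV : left_inverse presented_one presented_inv presented_mul.
Proof.
by move=> x; rewrite -[x]presented_class_repr presented_invE presented_mulE mulVg.
Qed.

Lemma presented_mulrV : right_inverse presented_one presented_inv presented_mul.
Proof.
by move=> x; rewrite -[x]presented_class_repr presented_invE presented_mulE mulgV.
Qed.

HB.instance Definition _ := isGroup.Build presented_group
  presented_mulA presented_mul1 presented_mulr1 presented_mulV presented_mulrV.

End PresentedGroup.

Inductive generator : Set := gen_a | gen_b | gen_t.

HB.instance Definition _ := gen_eqMixin generator.
HB.instance Definition _ := gen_choiceMixin generator.

Local Notation a := (free_gen gen_a).
Local Notation b := (free_gen gen_b).
Local Notation t := (free_gen gen_t).

Definition W (G : groupType) (s : nat) (x y : G) : G :=
  (\prod_(4 <= i < (4 + s).+1) (x * y ^+ i)) * x.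

(** The relation [l = r] is encoded by the relator [l / r]. *)
Definition group_G : groupType :=
  presented_group [set (t^-1 * a * t) / b; (t^-1 * b * t) / (a * b * a^-1)].

Definition group_Gs (s : nat) : groupType :=
  presented_group
    [set (t^-1 * a * t) / b; (t^-1 * b * t) / (W s b a * b * (W s a b)^-1)].

(* Main.v *)
(** The monodromy of both groups is an injective endomorphism [phi] of the free
    group [F2] on [x, y] with [phi x = y] and [phi y = y^n (x z x^-1)], where [z]
    is cyclically reduced, does not end with [x] and does not begin with
    [x^-1]; its image misses [x].  Hence [t a t^-1] lies outside the base
    [L = <a, b>], while [t^-1 L t <= L] becomes an equality in every finite
    quotient, so that [t a t^-1] cannot be separated from [L].
    That [t a t^-1] is not in [L] is seen in a permutation representation: [phi]
    being injective, [F2] acts freely on [F2 * R^nat], [R] a transversal of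
    [phi F2], both directly and through [phi], and a bijection intertwining the
    two actions serves as [t]. *)
Require Import Defs.
From HB Require Import structures.
From mathcomp Require Import fingroup all_boot.
From mathcomp Require Import boolp classical_sets cardinality.

Set Implicit Arguments.
Unset Strict Implicit.
Unset Printing Implicit Defensive.

Local Open Scope classical_set_scope.
Local Open Scope group_scope.

Local Notation hom G H := (UMagmaMorphism.type G H).

(** * Homomorphisms out of free groups and presented groups *)

Section FreeGroupLift.
Variables (X : choiceType) (H : groupType) (h : X -> H).

Definition letter_lift (p : X * bool) : H := if p.2 then (h p.1)^-1 else h p.1.

Definition word_lift (u : word X) : H := \prod_(p <- u) letter_lift p.

Lemma word_lift_free_eq u v : free_eq u v -> word_lift u = word_lift v.
Proof.
elim=> {u v} // [u v w _ -> _ ->//|u v x e].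
rewrite /word_lift !big_cat big_cons big_seq1 /letter_lift /=.
by case: e => /=; rewrite !gsimp.
Qed.

Definition free_lift (x : free_group X) : H := word_lift (repr x).

Lemma free_lift_class u : free_lift (free_class u) = word_lift u.
Proof. by apply/word_lift_free_eq/free_classP; rewrite free_class_repr. Qed.

Lemma free_class_cat (u v : word X) :
  free_class (u ++ v) = free_class u * free_class v.
Proof. by rewrite -free_mulE. Qed.

Lemma free_liftM : monoid_morphism free_lift.
Proof.
split=> [|x y]; first by rewrite free_lift_class /word_lift big_nil.
rewrite -[x]free_class_repr -[y]free_class_repr -free_class_cat.
by rewrite !free_lift_class /word_lift big_cat.
Qed.

HB.instance Definition _ :=
  isUMagmaMorphism.Build (free_group X) H free_lift free_liftM.

Lemma free_lift_gen x : free_lift (free_gen x) = h x.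
Proof. by rewrite free_lift_class /word_lift big_seq1. Qed.

End FreeGroupLift.

Lemma free_hom_ext (X : choiceType) (H : groupType)
    (f g : hom (free_group X) H) :
  (forall x, f (free_gen x) = g (free_gen x)) -> f =1 g.
Proof.
move=> fg x; rewrite -[x]free_class_repr.
elim: (repr x) => [|[y e] u IH]; first by rewrite !gmulf1.
rewrite -cat1s free_class_cat !gmulfM IH; congr (_ * _).
have -> : free_class [:: (y, e)] = if e then (free_gen y)^-1 else free_gen y.
  case: e => //; rewrite /free_gen -[RHS]/(free_inv _) free_invE.
  by rewrite /word_inv.
by case: e; rewrite ?gmulfV fg.
Qed.

(** Von Dyck's theorem: the kernel of [free_lift h] is normal and contains [R], hence also
    [normal_closure R], so evaluation on representatives is well defined. *)
Lemma presented_lift (X : choiceType) (R : set (free_group X)) (H : groupType)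
    (h : X -> H) : (forall r, R r -> free_lift h r = 1) ->
  exists f : hom (presented_group R) H,
    forall x, f (presented_class R x) = free_lift h x.
Proof.
move=> hR; pose f (x : presented_group R) : H := free_lift h (repr x).
have fE x : f (presented_class R x) = free_lift h x.
  have: normal_closure R (repr (presented_class R x) / x).
    by apply/presented_classP; rewrite presented_class_repr.
  move/(_ [set y | free_lift h y = 1]) => kerN.
  apply: divg1_eq; rewrite -gmulfF; apply: kerN; split; last exact: hR.
  split; first split; first exact: gmulf1.
    by move=> u v /= hu hv; rewrite gmulfF /= hu hv divg1.
  by move=> u g /= hu; rewrite gmulfJ /= hu conj1g.
have fM : monoid_morphism f.
  split=> [|x y]; first by rewrite fE gmulf1.
  rewrite -[x]presented_class_repr -[y]presented_class_repr.
  by rewrite -[_ * _]/(presented_mul _ _) presented_mulE !fE gmulfM.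
pose f' := isUMagmaMorphism.Build _ _ f fM.
by exists (HB.pack_for (hom (presented_group R) H) f f').
Qed.

(** * The group of permutations of an arbitrary type *)

Section SymmetricGroup.
Variable Y : Type.

(** The inverse is kept as data, so that inverting swaps fields; being determined by [sym_fun], it
    does not affect equality. *)
Record symmetric : Type := Symmetric {
  sym_fun :> Y -> Y;
  sym_inv_fun : Y -> Y;
  sym_funK : cancel sym_fun sym_inv_fun;
  sym_inv_funK : cancel sym_inv_fun sym_fun }.

HB.instance Definition _ := gen_eqMixin symmetric.
HB.instance Definition _ := gen_choiceMixin symmetric.

Lemma symP (p q : symmetric) : p =1 q -> p = q.
Proof.
case: p q => [f f' fK f'K] [g g' gK g'K] /= /funext fg; subst g.
have fg' : f' = g' by apply/funext => y; rewrite -{1}(g'K y) fK.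
subst g'; congr Symmetric; exact: Prop_irrelevance.
Qed.

Definition sym_one : symmetric :=
  @Symmetric id id (fun=> erefl) (fun=> erefl).
Definition sym_mul (p q : symmetric) : symmetric :=
  Symmetric (can_comp (@sym_funK p) (@sym_funK q))
            (can_comp (@sym_inv_funK q) (@sym_inv_funK p)).
Definition sym_inv (p : symmetric) : symmetric :=
  Symmetric (@sym_inv_funK p) (@sym_funK p).

Lemma sym_mulA : associative sym_mul. Proof. by move=> p q r; apply: symP. Qed.
Lemma sym_mul1 : left_id sym_one sym_mul.
Proof. by move=> p; apply: symP. Qed.
Lemma sym_mulr1 : right_id sym_one sym_mul.
Proof. by move=> p; apply: symP. Qed.
Lemma sym_mulV : left_inverse sym_one sym_inv sym_mul.
Proof. by move=> p; apply: symP => y /=; rewrite sym_funK. Qed.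
Lemma sym_mulrV : right_inverse sym_one sym_inv sym_mul.
Proof. by move=> p; apply: symP => y /=; rewrite sym_inv_funK. Qed.

HB.instance Definition _ := isGroup.Build symmetric
  sym_mulA sym_mul1 sym_mulr1 sym_mulV sym_mulrV.

End SymmetricGroup.

(** * A permutation model of the ascending HNN extension of [phi] *)

Section AscendingHNN.
Variables (M : groupType) (phi : hom M M).
Hypothesis phi_inj : injective phi.

Definition image_coset (x : M) : set M := [set y | exists h, y = phi h * x].

Definition coset_rep (x : M) : M := xget 1 (image_coset x).

Lemma coset_repM h x : coset_rep (phi h * x) = coset_rep x.
Proof.
rewrite /coset_rep; congr (xget 1 _); apply/seteqP; split=> y [k ->].
  by exists (k * h); rewrite gmulfM mulgA.
by exists (k / h); rewrite gmulfF mulgA mulgVK.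
Qed.

Lemma coset_repE x : exists h, coset_rep x = phi h * x.
Proof.
have xx : image_coset x x by exists 1; rewrite gmulf1 mul1g.
exact: (xgetI 1 xx).
Qed.

Lemma coset_rep_id x : coset_rep (coset_rep x) == coset_rep x.
Proof. by have [h {1}->] := coset_repE x; rewrite coset_repM. Qed.

Definition coset_part (x : M) : M := xget 1 [set h | x = phi h * coset_rep x].

Lemma coset_partE x : x = phi (coset_part x) * coset_rep x.
Proof.
have [h xE] := coset_repE x.
have hx : [set k | x = phi k * coset_rep x] h^-1 by rewrite /= xE gmulfV mulKg.
exact: (xgetI 1 hx).
Qed.

(** The condition is boolean, so elements are determined by their values. *)
Definition transversal_elt : Type := {r : M | coset_rep r == r}.
Definition transversal_part (x : M) : transversal_elt :=
  exist _ (coset_rep x) (coset_rep_id x).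

Definition hnn_set : Type := (M * (nat -> transversal_elt))%type.

(** Shifting the sequence leaves room for the coset representative of the
    first component, so that no information is lost. *)
Definition stable_fun (y : hnn_set) : hnn_set :=
  (coset_part y.1,
   fun n => if n is m.+1 then y.2 m else transversal_part y.1).

Definition stable_inv_fun (y : hnn_set) : hnn_set :=
  (phi y.1 * val (y.2 0), fun n => y.2 n.+1).

Lemma stable_funK : cancel stable_fun stable_inv_fun.
Proof. by move=> [x k]; rewrite /stable_inv_fun /= -coset_partE. Qed.

Lemma stable_inv_funK : cancel stable_inv_fun stable_fun.
Proof.
move=> [h k]; rewrite /stable_fun /=.
have rE : coset_rep (phi h * val (k 0)) = val (k 0).
  by rewrite coset_repM; exact/eqP/(svalP (k 0)).
congr pair.
  (* Injectivity of [phi] makes the factor [coset_part] unique. *)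
  by apply: phi_inj; apply: (mulIg (val (k 0))); rewrite -{1}rE -coset_partE.
by apply/funext => -[|n] //; apply: val_inj.
Qed.

Definition stable_letter : symmetric hnn_set :=
  Symmetric stable_funK stable_inv_funK.

Definition hnn_act (m : M) (y : hnn_set) : hnn_set := (m * y.1, y.2).

Lemma hnn_actK m : cancel (hnn_act m) (hnn_act m^-1).
Proof. by move=> [x k]; rewrite /hnn_act /= mulKg. Qed.

Lemma hnn_actVK m : cancel (hnn_act m^-1) (hnn_act m).
Proof. by move=> [x k]; rewrite /hnn_act /= mulVKg. Qed.

Definition hnn_base (m : M) : symmetric hnn_set :=
  Symmetric (@hnn_actK m) (@hnn_actVK m).

Lemma hnn_baseM : monoid_morphism hnn_base.
Proof.
split=> [|m n]; apply: symP => -[x k]; rewrite /= /hnn_act /=.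
  by rewrite mul1g.
by rewrite mulgA.
Qed.

HB.instance Definition _ :=
  isUMagmaMorphism.Build M (symmetric hnn_set) hnn_base hnn_baseM.

Lemma hnn_base_inj : injective hnn_base.
Proof.
move=> m n /(congr1 (fun p : symmetric hnn_set =>
  (p (1, fun=> transversal_part 1)).1)).
by rewrite /= !mulg1.
Qed.

(** Writing [x = phi h * r], the three maps lead from [x] through [h] and [m * h] to
    [phi (m * h) * r = phi m * x]. *)
Lemma stable_letter_conj m : hnn_base m ^ stable_letter = hnn_base (phi m).
Proof.
apply: (mulgI stable_letter); rewrite -conjgC.
apply: symP => y; apply: (can_inj stable_inv_funK).
rewrite -[LHS]/(stable_inv_fun (hnn_act m (stable_fun y))).
rewrite -[RHS]/(stable_inv_fun (stable_fun (hnn_act (phi m) y))) stable_funK.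
by case: y => x k; rewrite /stable_inv_fun /hnn_act /= gmulfM -mulgA -coset_partE.
Qed.

End AscendingHNN.

(** * Reduced words as normal forms in a free group *)

Lemma free_class_cons (X : choiceType) (p : X * bool) (u : word X) :
  free_class (p :: u) = free_class [:: p] * free_class u.
Proof. by rewrite -cat1s free_class_cat. Qed.

Section ReducedWords.
Variable X : choiceType.
Implicit Types (p q : X * bool) (u v : word X).

Definition inv_letter p : X * bool := (p.1, ~~ p.2).

Lemma inv_letterK : involutive inv_letter.
Proof. by case=> x e; rewrite /inv_letter /= negbK. Qed.

Definition reduced u : bool := sorted (fun p q => q != inv_letter p) u.

(** Left multiplication by a letter, acting on reduced words. *)
Definition push p v : word X :=
  if v is q :: v' then if q == inv_letter p then v' else p :: v else [:: p].

Definition reduce u : word X := foldr push [::] u.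

Lemma reduced_push p v : reduced v -> reduced (push p v).
Proof.
case: v => //= q v qv; case: eqP => [_|/eqP pq]; first exact: path_sorted qv.
by rewrite /reduced /= pq.
Qed.

Lemma reduce_reduced u : reduced (reduce u).
Proof. by elim: u => //= p u; apply: reduced_push. Qed.

Lemma reduced_reduce u : reduced u -> reduce u = u.
Proof.
elim: u => //= p u IH pu; rewrite IH; last exact: path_sorted pu.
by case: u pu {IH} => //= q u /andP[/negbTE->].
Qed.

(** Van der Waerden's argument: opposite letters act on reduced words by mutually inverse maps, so
    [reduce] is constant on the classes of [free_eq]. *)
Lemma push_inv p v : reduced v -> push p (push (inv_letter p) v) = v.
Proof.
case: v => [_|q v] /=; first by rewrite eqxx.
rewrite inv_letterK; case: eqP => [->|_ _] /=; last by rewrite eqxx.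
by case: v => //= r v /andP[/negbTE->].
Qed.

Lemma reduce_free_eq u v : free_eq u v -> reduce u = reduce v.
Proof.
elim=> {u v} // [u v w _ -> _ ->//|u v x e].
rewrite /reduce !foldr_cat; congr foldr.
exact/(push_inv (x, e))/reduce_reduced.
Qed.

Lemma free_eq_reduce u : free_eq u (reduce u).
Proof.
elim: u => [|p u IH]; first exact: free_eq_refl.
apply: (@free_eq_trans _ _ (p :: reduce u)).
  rewrite -cat1s -[p :: reduce u]cat1s.
  by apply: free_eq_cat => //; exact: free_eq_refl.
rewrite [reduce (p :: u)]/=.
case: (reduce u) => [|q v] /=; first exact: free_eq_refl.
case: eqP => [->|_]; last exact: free_eq_refl.
by case: p => x e; exact: (free_eq_cancel [::]).
Qed.

Lemma reduced_class_inj u v :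
  reduced u -> reduced v -> free_class u = free_class v -> u = v.
Proof.
by move=> /reduced_reduce{2}<- /reduced_reduce{2}<- /free_classP/reduce_free_eq.
Qed.

Lemma free_class_reduced (x : free_group X) :
  exists2 u, reduced u & x = free_class u.
Proof.
exists (reduce (repr x)); first exact: reduce_reduced.
by rewrite -{1}[x]free_class_repr; apply/free_classP/free_eq_reduce.
Qed.

Lemma reduced_cat u v p q :
  reduced (rcons u p ++ q :: v) =
  [&& reduced (rcons u p), q != inv_letter p & reduced (q :: v)].
Proof.
rewrite /reduced; case: u => [|r u] //=.
by rewrite cat_path /= last_rcons.
Qed.

Lemma reduced_catl u v : reduced (u ++ v) -> reduced u.
Proof. by case: u => //= p u; rewrite /reduced /= cat_path => /andP[]. Qed.

Lemma reduced_catr u v : reduced (u ++ v) -> reduced v.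
Proof.
by case: u => //= p u; rewrite /reduced /= cat_path => /andP[_ /path_sorted].
Qed.

(** Only adjacent letters matter, and as [v] is nonempty each adjacent pair lies in [u ++ v] or in
    [v ++ w]. *)
Lemma reduced_glue u v w :
  v != [::] -> reduced (u ++ v) -> reduced (v ++ w) -> reduced (u ++ v ++ w).
Proof.
case/lastP: u => [//|u p]; case: v => [|q v _]; first by rewrite eqxx.
by rewrite cat_cons !reduced_cat => /and3P[-> -> _].
Qed.

Lemma reduced_inv u : reduced (word_inv u) = reduced u.
Proof.
rewrite /reduced /word_inv rev_sorted sorted_map.
case: u => //= p u; apply: eq_path => {p u} p q /=.
by rewrite -[(q.1, _)]/(inv_letter q) inv_letterK eq_sym.
Qed.

Lemma free_class_inv u : free_class (word_inv u) = (free_class u)^-1.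
Proof. by rewrite -free_invE. Qed.

Lemma word_inv_cat u v : word_inv (u ++ v) = word_inv v ++ word_inv u.
Proof. by rewrite /word_inv map_cat rev_cat. Qed.

(** Cancelling letters have opposite signs. *)
Lemma reduced_same_sign e u : all (fun p => p.2 == e) u -> reduced u.
Proof.
case: u => //= p u /andP[/eqP pe]; rewrite /reduced /= => ue.
elim: u p pe ue => //= q u IH p pe /andP[/eqP qe ue].
rewrite IH // andbT; apply/eqP => /(congr1 snd) /=.
by rewrite pe qe; case: e {IH pe ue qe}.
Qed.

End ReducedWords.

(** * Injectivity of the map with [x -> y] and [y -> x z x^-1] *)

Local Notation F2 := (free_group bool).
Local Notation x := (free_gen false : F2).
Local Notation y := (free_gen true : F2).

Section ConjugateLift.
Variable z : word bool.
Hypotheses (z_neq0 : z != [::]) (z_cyc : reduced (z ++ z)).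
Hypothesis xz_red : reduced ((false, false) :: z ++ [:: (false, true)]).

Let c (e : bool) : word bool := if e then word_inv z else z.

Let c_neq0 e : c e != [::].
Proof.
by rewrite -size_eq0 /c; case: e; rewrite /word_inv ?size_rev ?size_map size_eq0.
Qed.

Let c_cyc e : reduced (c e ++ c e).
Proof. by case: e; rewrite //= -word_inv_cat reduced_inv. Qed.

Let xc_red e : reduced ((false, false) :: c e ++ [:: (false, true)]).
Proof.
case: e; last exact: xz_red.
rewrite -reduced_inv.
by rewrite -cat1s !word_inv_cat (_ : word_inv (word_inv z) = z) // /word_inv
  map_rev revK -map_comp map_id_in // => -[? ?] _ /=; rewrite negbK.
Qed.

Definition conjugate_lift : hom F2 F2 :=
  free_lift (fun e : bool => if e then x * free_class z * x^-1 else y).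

Let conjugate_lift_letter e :
  conjugate_lift (free_class [:: (true, e)]) = x * free_class (c e) * x^-1.
Proof.
rewrite /= free_lift_class /word_lift big_seq1 /letter_lift /=.
by case: e => //=; rewrite free_class_inv !gnorm.
Qed.

Let xVE : x^-1 = free_class [:: (false, true)].
Proof. by rewrite /free_gen -free_class_inv. Qed.

(** No cancellation reaches the first letter of a syllable: a word starting
    with [x^±1] is mapped to one starting with [y^±1], and a word starting with
    [y^±1] to one starting with [x z^±1]. *)
Lemma conjugate_lift_head p u : reduced (p :: u) ->
  exists v, [/\ reduced v, free_class v = conjugate_lift (free_class (p :: u))
    & if p.1 then exists r, v = (false, false) :: c p.2 ++ r
      else exists r, v = (true, p.2) :: r].
Proof.
elim: u p => [|q u IH] p pu.
  case: p pu => -[] e _.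
    exists ((false, false) :: c e ++ [:: (false, true)]); split => //; last first.
      by exists [:: (false, true)].
    rewrite conjugate_lift_letter xVE -cat1s !free_class_cat.
    by rewrite mulgA.
  exists [:: (true, e)]; split => //; last by exists [::].
  rewrite /= free_lift_class /word_lift big_seq1 /letter_lift /=.
  by case: e => //; rewrite /free_gen -free_class_inv.
have qu : reduced (q :: u) by exact: path_sorted pu.
have [v [v_red vE vP]] := IH q qu.
have pq : q != inv_letter p by move: pu => /= /andP[].
rewrite -cat1s free_class_cat gmulfM -vE.
case: p pq pu => -[] e pq pu.
  rewrite conjugate_lift_letter.
  case: q pq qu vE vP {pu} => -[] e' pq qu vE /= [r vr].
    (* Adjacent [y]-letters have equal signs as the word is reduced; the inner [x^-1 x] cancels, and
       [c e] meets [c e] without cancellation by [c_cyc]. *)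
    have ee' : e' = e.
      apply/eqP; move: pq; apply: contraNT; rewrite /inv_letter.
      by case: e e' {vE vr qu} => -[].
    exists ((false, false) :: c e ++ c e ++ r); split; last by exists (c e ++ r).
      rewrite -cat1s; apply: (reduced_glue (u := [:: _])) => //.
        exact: (@reduced_catl _ ((false, false) :: c e) _ (xc_red e)).
      apply: reduced_glue => //.
      by move: v_red; rewrite vr -cat1s ee' => /reduced_catr.
    rewrite vr ee' (free_class_cons _ (c e ++ c e ++ r)).
    by rewrite (free_class_cons _ (c e ++ r)) !free_class_cat !gnorm.
  (* Here [v] begins with [y^±1], which does not cancel the final [x^-1]. *)
  exists (((false, false) :: c e ++ [:: (false, true)]) ++ v).
  split; last by exists ((false, true) :: v); rewrite /= -catA.
    rewrite vr cats1 -rcons_cons reduced_cat rcons_cons -cats1 xc_red.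
    by rewrite -vr v_red.
  by rewrite free_class_cat -cat1s !free_class_cat -xVE mulgA.
(* After [y^±1] comes [x], or a [y]-letter of the same sign because [p] and [q] do not cancel. *)
exists ((true, e) :: v); split; last by exists v.
  case: q pq qu vE vP {pu} => -[] e' pq qu vE /= [r vr]; move: v_red; rewrite vr //.
  rewrite /reduced /= => ->; rewrite andbT; move: pq.
  by case: e e' {vr qu vE} => -[].
rewrite -cat1s free_class_cat; congr (_ * _).
rewrite /= free_lift_class /word_lift big_seq1 /letter_lift /=.
by case: e {pq pu} => //; rewrite /free_gen -free_class_inv.
Qed.

Lemma conjugate_lift_inj : injective conjugate_lift.
Proof.
apply: gmulf_inj => g; have [[|p u] u_red ->//] := free_class_reduced g.
have [v [v_red vE vP]] := conjugate_lift_head u_red.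
rewrite -vE => /(reduced_class_inj v_red (isT : reduced [::])) v0.
by case: ifP vP => _ [r]; rewrite v0.
Qed.

(** The reduced word of an image is empty, begins with [y^±1], or has [x] followed by the nonempty
    [c e]. *)
Lemma conjugate_lift_neqx g : conjugate_lift g <> x.
Proof.
have [[|p u] u_red ->] := free_class_reduced g.
  have -> : free_class [::] = 1 :> F2 by [].
  rewrite gmulf1.
  by move=> /(reduced_class_inj (isT : reduced [::]) (isT : reduced [:: _])).
have [v [v_red vE vP]] := conjugate_lift_head u_red.
rewrite -vE => /(reduced_class_inj v_red (isT : reduced [:: _])) vx.
case: ifP vP => _ [r]; rewrite vx // => -[].
by case: (c _) (c_neq0 p.2).
Qed.

End ConjugateLift.

(** * The monodromy, with a power of [y] in front *)

Section MonodromyLift.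
Variable z : word bool.
Hypotheses (z_neq0 : z != [::]) (z_cyc : reduced (z ++ z)).
Hypothesis xz_red : reduced ((false, false) :: z ++ [:: (false, true)]).
Variable n : nat.

Definition monodromy : hom F2 F2 :=
  free_lift (fun e : bool => if e then y ^+ n * (x * free_class z * x^-1) else y).

(** A Nielsen automorphism with inverse [unshear]; as [conjugate_lift z] sends [x^n y] to
    [y^n x z x^-1], it accounts for the factor [y^n]. *)
Let shear : hom F2 F2 := free_lift (fun e : bool => if e then x ^+ n * y else x).
Let unshear : hom F2 F2 := free_lift (fun e : bool => if e then x ^- n * y else x).

Let shearK : cancel shear unshear.
Proof.
apply: (@free_hom_ext _ _ (unshear \o shear : hom F2 F2) (idfun : hom F2 F2)).
case; rewrite /= !free_lift_gen // gmulfM gmulfXn /= !free_lift_gen.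
by rewrite mulVKg.
Qed.

Let monodromyE g : monodromy g = conjugate_lift z (shear g).
Proof.
apply: (@free_hom_ext _ _ monodromy (conjugate_lift z \o shear : hom F2 F2)).
by case; rewrite /= !free_lift_gen // gmulfM gmulfXn /= !free_lift_gen.
Qed.

Lemma monodromy_inj : injective monodromy.
Proof.
move=> g h; rewrite !monodromyE => /(conjugate_lift_inj z_neq0 z_cyc xz_red).
exact: (can_inj shearK).
Qed.

Lemma monodromy_neqx g : monodromy g <> x.
Proof. by rewrite monodromyE; apply: conjugate_lift_neqx. Qed.

End MonodromyLift.

(** * Non-separability of ascending HNN extensions of [F2] *)

Local Notation a := (free_gen gen_a).
Local Notation b := (free_gen gen_b).
Local Notation t := (free_gen gen_t).

Definition base_inclusion : F2 -> free_group generator :=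
  free_lift (fun e : bool => free_gen (if e then gen_b else gen_a)).

HB.instance Definition _ := UMagmaMorphism.on base_inclusion.

Lemma generated_subgroupP (G : groupType) (A : set G) :
  is_subgroup (generated_subgroup A).
Proof.
split=> [M [[M1 _] _] //|u v Au Av M MP].
by apply: MP.1.2; [exact: Au|exact: Av].
Qed.

Lemma finite_conj_sub (G : groupType) (H : finGroupType)
    (f : {multiplicative G -> H}) (L : set G) (s g : G) :
  (forall u, L u -> L (u ^ s)) -> L (g ^ s) -> (f @` L) (f g).
Proof.
move=> LJ Lgs; have fJ u : f (u ^ s) = f u ^ f s.
  by apply: (mulgI (f s)); rewrite -gmulfM -!conjgC gmulfM.
pose A : {set H} := [set u | `[< (f @` L) u >]]%SET.
have AJ : (A :^ f s = A)%SET.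
  apply/eqP; rewrite eqEcard cardJg leqnn andbT.
  apply/fintype.subsetP => _ /imsetP[u uA ->].
  move: uA; rewrite !finset.in_set => /asboolP[v Lv <-].
  by apply/asboolP; exists (v ^ s); [exact: LJ|rewrite fJ].
have: f (g ^ s) \in A :^ f s.
  by rewrite AJ finset.in_set; apply/asboolP; exists (g ^ s).
by rewrite fJ memJ_conjg finset.in_set => /asboolP.
Qed.

Lemma ascending_not_separable (w : F2) (phi : hom F2 F2) :
  phi x = y -> phi y = w -> injective phi -> (forall g, phi g <> x) ->
  ~ subgroup_separable (presented_group
    [set (t^-1 * a * t) / b; (t^-1 * b * t) / base_inclusion w]).
Proof.
move=> phix phiy phi_inj phi_neqx.
set R := [set _; _]; set P := presented_group R.
pose cl := presented_class R.
have clM u v : cl (u * v) = cl u * cl v by apply/esym/presented_mulE.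
have clJ u v : cl (u ^ v) = cl u ^ cl v.
  apply: (mulgI (cl v)); rewrite -clM -!conjgC clM //.
have rel u v : R (t^-1 * u * t / v) -> cl u ^ cl t = cl v.
  move=> Ruv; rewrite -clJ; apply/presented_classP; rewrite /conjg mulgA.
  exact: sub_gen_smallest.
pose L : set P := generated_subgroup [set cl a; cl b].
have [L1 LF] : is_subgroup L := @generated_subgroupP _ _.
have LV u : L u -> L u^-1 by move=> Lu; rewrite -div1g; apply: LF.
have LM u v : L u -> L v -> L (u * v).
  by move=> Lu Lv; rewrite -[v]invgK; apply: LF => //; apply: LV.
have La : L (cl a) by apply: sub_gen_smallest; left.
have Lb : L (cl b) by apply: sub_gen_smallest; right.
have cl1 : cl 1 = 1 by apply: (mulgI (cl 1)); rewrite -clM !mulg1.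
have clV u : cl u^-1 = (cl u)^-1.
  by apply: (mulgI (cl u)); rewrite -clM !mulgV.
have Lbase v : L (cl (base_inclusion v)).
  rewrite -[v]free_class_repr /base_inclusion /= free_lift_class /word_lift.
  elim: (repr v) => [|[e i] u IH]; first by rewrite big_nil cl1.
  rewrite big_cons clM; apply: LM => //; rewrite /letter_lift /=.
  by case: i; rewrite ?clV; try apply: LV; case: e.
have LJ u : L u -> L (u ^ cl t).
  (* The elements whose conjugate by [t] lies in [L] form a subgroup, which contains the generators
     by the two relations. *)
  move=> /(_ [set v | L (v ^ cl t)]); apply; split.
    split=> /= [|v v' Lv Lv']; first by rewrite conj1g.
    by rewrite conjMg conjVg; apply: LF.
  move=> _ [] -> /=; [rewrite (rel a b)|rewrite (rel b (base_inclusion w))] => //.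
  - by left.
  - by right.
move/(_ L) => sep.
(* The element is [t a t^-1]; conjugating it by [t] gives back [a]. *)
have [] := sep _ (cl a ^ (cl t)^-1).
- by exists [set cl a; cl b].
- pose base := hnn_base phi; pose tau := stable_letter phi_inj.
  have baseJ m : base m ^ tau = base (phi m) by exact: stable_letter_conj.
  have baseJA m : tau^-1 * base m * tau = base (phi m).
    by rewrite -mulgA; exact: baseJ.
  (* In the permutation model the relators become trivial because [tau] conjugates [base m] to
     [base (phi m)]. *)
  pose h (i : generator) : symmetric (hnn_set phi) :=
    match i with gen_a => base x | gen_b => base y | gen_t => tau end.
  have h_base : free_lift h \o base_inclusion =1 base.
    apply: (free_hom_ext (f := free_lift h \o base_inclusion : hom _ _)
                         (g := base : hom _ _)).
    by case; rewrite /= /base_inclusion !free_lift_gen.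
  have hR r : R r -> free_lift h r = 1.
    case=> ->; rewrite gmulfF !gmulfM gmulfV /= !free_lift_gen /=.
      by rewrite baseJA phix divgg.
    rewrite baseJA phiy.
    by rewrite -[free_lift h _]/((_ \o base_inclusion) w) h_base divgg.
  have [f fE] := presented_lift hR.
  (* [L] is mapped into the image of [base], since [a] and [b] are. *)
  move=> Lg; have [m fm] : exists m, f (cl a ^ (cl t)^-1) = base m.
    apply: (Lg [set u | exists m, f u = base m]); split.
      split=> /=; first by exists 1; rewrite gmulf1 /base gmulf1.
      move=> u v [m fu] [m' fv]; exists (m / m').
      by rewrite gmulfF fu fv /base gmulfF.
    by move=> _ [] -> /=; [exists x|exists y]; rewrite fE free_lift_gen.
  (* Conjugating by [tau] turns [f (t a t^-1) = base m] into [base x = base (phi m)]. *)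
  apply: (phi_neqx m); apply: (@hnn_base_inj _ phi).
  rewrite -/base -baseJ -fm gmulfJ gmulfV !fE !free_lift_gen /=.
  by rewrite conjgKV.
- move=> H [f]; apply; apply: (@finite_conj_sub _ H f L (cl t) _ LJ).
  by rewrite conjgKV.
Qed.

(** * Both relators in the form [y^n (x z x^-1)] *)

Lemma gmulf_W (G H : groupType) (f : hom G H) s u v :
  f (W s u v) = W s (f u) (f v).
Proof.
rewrite /W gmulfM gmulf_prod; congr (_ * _).
by apply: eq_bigr => i _; rewrite gmulfM gmulfXn.
Qed.

Section PowerBlocks.
Variables (X : choiceType) (p q : X).

Definition power_blocks (m n : nat) : word X :=
  flatten [seq (p, false) :: nseq i (q, false) | i <- index_iota m n].

Lemma free_class_nseq i : free_class (nseq i (q, false)) = free_gen q ^+ i.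
Proof. by elim: i => //= i IH; rewrite free_class_cons IH expgS. Qed.

Lemma free_class_power_blocks m n :
  free_class (power_blocks m n) =
  \prod_(m <= i < n) (free_gen p * free_gen q ^+ i).
Proof.
rewrite /power_blocks; elim: (index_iota m n) => [|i r IH] /=.
  by rewrite big_nil.
by rewrite big_cons free_class_cons free_class_cat IH free_class_nseq mulgA.
Qed.

Lemma power_blocks_positive m n : all (fun r => r.2 == false) (power_blocks m n).
Proof.
rewrite /power_blocks; elim: (index_iota m n) => //= i r IH.
by rewrite all_cat IH andbT; apply/allP => _ /nseqP[->].
Qed.

End PowerBlocks.

Lemma relator_G :
  x * y * x^-1 = y ^+ 0 * (x * free_class [:: (true, false)] * x^-1).
Proof. by rewrite mul1g. Qed.

(** [W s y x * y = y x (pos_part s)] and [W s x y = x (neg_part s)]. *)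
Definition pos_part s : word bool :=
  nseq 3 (false, false) ++ power_blocks true false 5 (4 + s).+1 ++
  nseq 2 (true, false).

Definition neg_part s : word bool :=
  nseq 4 (true, false) ++ power_blocks false true 5 (4 + s).+1 ++
  [:: (false, false)].

(** Splitting off the block [i = 4] exposes the initial [y x] of [W s y x] and the initial [x] of
    [W s x y], whose inverse is the final [x^-1]; so [n = 1]. *)
Lemma relator_Gs s :
  W s y x * y * (W s x y)^-1 =
  y ^+ 1 * (x * free_class (pos_part s ++ word_inv (neg_part s)) * x^-1).
Proof.
rewrite free_class_cat free_class_inv !free_class_cat !free_class_power_blocks.
rewrite !free_class_nseq /W !(big_ltn (_ : 4 < (4 + s).+1)) //.
rewrite -[free_class [:: (false, false)]]/(free_gen false).
by rewrite !expgS !expg0 !gnorm.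
Qed.


(** Here and in [neg_partE] the end letters are exposed, as only they decide about cancellation at
    junctions. *)
Lemma pos_partE s : pos_part s =
  rcons ((false, false) ::
    nseq 2 (false, false) ++ power_blocks true false 5 (4 + s).+1 ++
    [:: (true, false)])
    (true, false).
Proof. by rewrite -cats1 /= -!catA. Qed.

Lemma neg_partE s : word_inv (neg_part s) =
  rcons ((false, true) ::
    word_inv (nseq 3 (true, false) ++ power_blocks false true 5 (4 + s).+1))
    (true, true).
Proof.
rewrite -cats1 -(cat1s (false, true)) -catA.
by rewrite -[[:: (true, true)]]/(word_inv [:: (true, false)])
  -[[:: (false, true)]]/(word_inv [:: (false, false)]) -!word_inv_cat.
Qed.

Section PositiveNegative.
Variables u v : word bool.
Hypothesis u_pos : all (fun r => r.2 == false) u.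
Hypothesis v_neg : all (fun r => r.2 == true) v.

Let P : word bool := rcons ((false, false) :: u) (true, false).
Let N : word bool := rcons ((false, true) :: v) (true, true).

(** Inside [P] and [N] all signs agree, and at the junction [y] meets [x^-1]. *)
Let PN_red : reduced (P ++ N).
Proof.
rewrite /N rcons_cons reduced_cat -rcons_cons andbA andbAC.
apply/andP; split=> //; apply/andP; split.
  by apply: (reduced_same_sign (e := false)); rewrite all_rcons /= u_pos.
by apply: (reduced_same_sign (e := true)); rewrite all_rcons /= v_neg.
Qed.

Let NP_red : reduced (N ++ P).
Proof.
rewrite /P rcons_cons reduced_cat -rcons_cons.
by rewrite (reduced_catl PN_red) (reduced_catr PN_red).
Qed.

Lemma pos_neg_cyc : reduced ((P ++ N) ++ (P ++ N)).
Proof.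
rewrite -catA; apply: reduced_glue => //.
exact: (@reduced_glue _ N P N).
Qed.

(** The added [x] precedes the positive [P], and the added [x^-1] follows the negative [N]. *)
Lemma pos_neg_conj : reduced ((false, false) :: (P ++ N) ++ [:: (false, true)]).
Proof.
rewrite -cat1s -catA; apply: (reduced_glue (u := [:: _])) => //.
  by apply: (reduced_same_sign (e := false)); rewrite /= all_rcons /= u_pos.
apply: reduced_glue => //.
by apply: (reduced_same_sign (e := true)); rewrite all_cat all_rcons /= v_neg.
Qed.

End PositiveNegative.

Lemma word_inv_sign (X : choiceType) (e : bool) (u : word X) :
  all (fun r => r.2 == e) u -> all (fun r => r.2 == ~~ e) (word_inv u).
Proof.
by rewrite all_rev all_map; apply: sub_all => -[? e'] /eqP /= ->.
Qed.

(** * Application to the two presentations *)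

Lemma conjugate_relator_not_separable (z : word bool) (n : nat) (w : F2) r :
  w = y ^+ n * (x * free_class z * x^-1) -> base_inclusion w = r ->
  z != [::] -> reduced (z ++ z) ->
  reduced ((false, false) :: z ++ [:: (false, true)]) ->
  ~ subgroup_separable (presented_group
    [set (t^-1 * a * t) / b; (t^-1 * b * t) / r]).
Proof.
move=> -> <- z0 zz xz; apply: (ascending_not_separable (phi := monodromy z n)).
- exact: free_lift_gen.
- exact: free_lift_gen.
- exact: monodromy_inj.
- exact: monodromy_neqx.
Qed.

Lemma base_inclusion_x : base_inclusion x = a.
Proof. exact: free_lift_gen. Qed.

Lemma base_inclusion_y : base_inclusion y = b.
Proof. exact: free_lift_gen. Qed.

Theorem proposition4 :
  ~ subgroup_separable group_G /\
  (forall s : nat, 3 <= s -> ~ subgroup_separable (group_Gs s)).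
Proof.
split=> [|s _].
  (* Here [z] is the single letter [y], so its conditions hold by computation. *)
  apply: (conjugate_relator_not_separable relator_G) => //.
  rewrite 2!gmulfM gmulfV /=.
  by rewrite base_inclusion_x base_inclusion_y.
apply: (conjugate_relator_not_separable (relator_Gs s)) => //.
- rewrite 2!gmulfM gmulfV /= !gmulf_W /=.
  by rewrite base_inclusion_x base_inclusion_y.
- rewrite pos_partE neg_partE; apply: pos_neg_cyc.
    by rewrite !all_cat power_blocks_positive.
  by apply: (@word_inv_sign _ false); rewrite all_cat power_blocks_positive.
- rewrite pos_partE neg_partE; apply: pos_neg_conj.
    by rewrite !all_cat power_blocks_positive.
  by apply: (@word_inv_sign _ false); rewrite all_cat power_blocks_positive.
Qed.
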